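(* Let $V=\{1,\dots,n\}$ with $n\ge1$, let $f:2^V\to\mathbb{R}_+$ be a non-decreasing submodular function with $f(\emptyset)=0$, and let $w\in\mathbb{R}^n$ have all $w_i>0$. Suppose $S^*$ is a non-empty subset of $V$ that minimizes $f(S)/w^{-1}(S)$ over non-empty $S\subseteq V$. Then the value of the game $\Gamma_{\max}(\mathcal{B}(f),w)$ is equal to $f(S^* )/w^{-1}(S^* )$. An optimal strategy for Player 2 is $y^{S^*}$. An optimal strategy for Player 1 is $x^{\mathcal{S}}$, where $\mathcal{S}=(S_1,\dots,S_r)$ is any $f$-$w$ decomposition of $V$.
   Context: For $x\in\mathbb{R}^n$ and $S\subseteq V$, write $x(S)=\sum_{j\in S}x_j$. The base polyhedron is $\mathcal{B}(f)=\{x\in\mathbb{R}^n_+: x(S)\le f(S)\text{ for all }S\subseteq V,\ x(V)=f(V)\}$. Its vertices are the points $x^\sigma$, for permutations $\sigma$ of $V$, given by $x^\sigma_{\sigma(j)}=f(\{\sigma(1),\dots,\sigma(j)\})-f(\{\sigma(1),\dots,\sigma(j-1)\})$, $j=1,\dots,n$. The zero-sum game $\Gamma_{\max}(\mathcal{B}(f),w)$: a pure strategy of Player 1 (the maximizer) is a permutation $\sigma$ of $V$ (equivalently a vertex $x^\sigma$), a pure strategy of Player 2 (the minimizer) is $j\in V$, and the payoff is $P(\sigma,j)=w_jx^\sigma_j$. A mixed strategy of Player 1 is identified with a point $x\in\mathcal{B}(f)$. A mixed strategy of Player 2 is identified with a point of the simplex $C=\{\sum_{j=1}^n\theta_jw_je^j:\theta_j\ge0,\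 \sum_j\theta_j=1\}$, where $e^j$ is the $j$th coordinate vector. The expected payoff is $P(x,y)=x^Ty$. The value is $v=\max_{x\in\mathcal{B}(f)}\min_{j}w_jx_j=\min_{y\in C}\max_{\sigma}(x^\sigma)^Ty$. A Player 1 strategy $x$ is optimal if $\min_jw_jx_j=v$, and a Player 2 strategy $y$ is optimal if $\max_{x\in\mathcal{B}(f)}x^Ty=v$. For $S\subseteq V$, $w^{-1}(S)=\sum_{i\in S}1/w_i$. For $S\ne\emptyset$, $y^S=\frac{1}{w^{-1}(S)}\sum_{i\in S}e^i\in C$. $f$-$w$ decomposition: for $T\subseteq V$ and non-empty $S\subseteq V\setminus T$, let $h_T(S)=\frac{f(T\cup S)-f(T)}{w^{-1}(S)}$. Set $S_0=\emptyset$. Given $S_0,\dots,S_j$, let $S^j=S_1\cup\cdots\cup S_j$ (with $S^0=\emptyset$). If $S^j=V$, set $r=j$ and stop; otherwise let $S_{j+1}$ be any non-empty set $S\subseteq V\setminus S^j$ minimizing $h_{S^j}(S)$. Any resulting $\mathcal{S}=(S_1,\dots,S_r)$ is an $f$-$w$ decomposition of $V$. The associated strategy $x^{\mathcal{S}}$ is defined by $x^{\mathcal{S}}_i=w_i^{-1}h_{S^{j-1}}(S_j)$ for all $i\in S_j$, $j=1,\dots,r$. *)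

(* Defs.v *)
From HB Require Import structures.
From mathcomp Require Import all_boot all_order all_algebra all_fingroup.
From mathcomp Require Import reals.

Set Implicit Arguments.
Unset Strict Implicit.
Unset Printing Implicit Defensive.

Import Order.TTheory GRing.Theory Num.Theory.
Local Open Scope ring_scope.

(* The ground set V = {1, ..., n} is 'I_n (indices shifted to 0, ..., n - 1),
   points of R^n are row vectors. *)

Definition is_max (R : realType) (A : R -> Prop) (v : R) : Prop :=
  A v /\ forall u, A u -> u <= v.

Definition is_min (R : realType) (A : R -> Prop) (v : R) : Prop :=
  A v /\ forall u, A u -> v <= u.

Definition nondecreasing_setfun (R : realType) (n : nat)
    (f : {set 'I_n} -> R) : Prop :=
  forall S T : {set 'I_n}, S \subset T -> f S <= f T.

Definition submodular (R : realType) (n : nat) (f : {set 'I_n} -> R) : Prop :=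
  forall S T : {set 'I_n}, f (S :|: T) + f (S :&: T) <= f S + f T.

Definition base_polyhedron (R : realType) (n : nat) (f : {set 'I_n} -> R)
    (x : 'rV[R]_n) : Prop :=
  [/\ forall i, 0 <= x 0 i,
      forall S : {set 'I_n}, \sum_(i in S) x 0 i <= f S
    & \sum_(i in [set: 'I_n]) x 0 i = f [set: 'I_n]].

(* The formula x^s_(s j) = f {s 1, .., s j} - f {s 1, .., s (j - 1)}, read at
   the coordinate i = s j. *)
Definition vertex (R : realType) (n : nat) (f : {set 'I_n} -> R)
    (s : 'S_n) : 'rV[R]_n :=
  \row_i let j := (s^-1)%g i in
    f (s @: [set k : 'I_n | (k <= j)%N]) -
    f (s @: [set k : 'I_n | (k < j)%N]).

Definition pure_payoff (R : realType) (n : nat) (f : {set 'I_n} -> R)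
    (w : 'rV[R]_n) (s : 'S_n) (j : 'I_n) : R :=
  w 0 j * vertex f s 0 j.

(* A mixed strategy of Player 1 is identified with the corresponding convex
   combination of vertices x^s, that is, with a point of the base polyhedron;
   a mixed strategy theta of Player 2 is identified with the point
   \sum_j theta_j w_j e^j of the simplex C below. *)
Definition simplexC (R : realType) (n : nat) (w : 'rV[R]_n)
    (y : 'rV[R]_n) : Prop :=
  exists theta : 'I_n -> R,
    [/\ forall j, 0 <= theta j,
        \sum_j theta j = 1
      & y = \sum_j (theta j * w 0 j) *: delta_mx 0 j].

Definition expected_payoff (R : realType) (n : nat) (x y : 'rV[R]_n) : R :=
  \sum_i x 0 i * y 0 i.

Lemma expected_payoff_pure (R : realType) (n : nat) (f : {set 'I_n} -> R)
    (w : 'rV[R]_n) (s : 'S_n) (j : 'I_n) :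
  expected_payoff (vertex f s) (w 0 j *: delta_mx 0 j) = pure_payoff f w s j.
Proof.
rewrite /expected_payoff /pure_payoff (bigD1 j) //= big1 => [|i ij].
  by rewrite addr0 !mxE !eqxx /= mulr1 mulrC.
by rewrite 2!mxE (mxE _ _ 0 i) (negPf ij) andbF !mulr0.
Qed.

Definition guarantee1 (R : realType) (n : nat) (w x : 'rV[R]_n) (u : R) : Prop :=
  is_min (fun t => exists j : 'I_n, t = w 0 j * x 0 j) u.

Definition guarantee2 (R : realType) (n : nat) (f : {set 'I_n} -> R)
    (y : 'rV[R]_n) (u : R) : Prop :=
  is_max (fun t => exists s : 'S_n, t = expected_payoff (vertex f s) y) u.

Definition game_value (R : realType) (n : nat) (f : {set 'I_n} -> R)
    (w : 'rV[R]_n) (v : R) : Prop :=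
  is_max (fun u => exists2 x, base_polyhedron f x & guarantee1 w x u) v /\
  is_min (fun u => exists2 y, simplexC w y & guarantee2 f y u) v.

Definition optimal1 (R : realType) (n : nat) (f : {set 'I_n} -> R)
    (w x : 'rV[R]_n) : Prop :=
  base_polyhedron f x /\ exists2 v, game_value f w v & guarantee1 w x v.

Definition optimal2 (R : realType) (n : nat) (f : {set 'I_n} -> R)
    (w y : 'rV[R]_n) : Prop :=
  simplexC w y /\
  exists2 v, game_value f w v &
    is_max (fun t => exists2 x, base_polyhedron f x & t = expected_payoff x y) v.

Definition winv (R : realType) (n : nat) (w : 'rV[R]_n) (S : {set 'I_n}) : R :=
  \sum_(i in S) (w 0 i)^-1.

Definition ystrat (R : realType) (n : nat) (w : 'rV[R]_n)
    (S : {set 'I_n}) : 'rV[R]_n :=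
  (winv w S)^-1 *: \sum_(i in S) delta_mx 0 i.

Definition hfun (R : realType) (n : nat) (f : {set 'I_n} -> R) (w : 'rV[R]_n)
    (T S : {set 'I_n}) : R :=
  (f (T :|: S) - f T) / winv w S.

(* A sequence (S_1, ..., S_r) is ss : seq {set 'I_n}, so that S_{j+1} is
   nth set0 ss j, and S^j is the union of the first j terms. *)
Definition prefix_union (n : nat) (ss : seq {set 'I_n}) (j : nat) : {set 'I_n} :=
  \bigcup_(S <- take j ss) S.

(* Non-emptiness of S_{j+1} forces S^j != V for j < r, so the construction
   indeed stops at the first j with S^j = V. *)
Definition fw_decomposition (R : realType) (n : nat) (f : {set 'I_n} -> R)
    (w : 'rV[R]_n) (ss : seq {set 'I_n}) : Prop :=
  (forall j, (j < size ss)%N ->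
     let T := prefix_union ss j in
     let S := nth set0 ss j in
     [/\ S != set0, S \subset ~: T
       & forall S' : {set 'I_n}, S' != set0 -> S' \subset ~: T ->
           hfun f w T S <= hfun f w T S']) /\
  prefix_union ss (size ss) = [set: 'I_n].

(* The terms of a decomposition partition V, so the first term containing i
   is the only one. *)
Definition xstrat (R : realType) (n : nat) (f : {set 'I_n} -> R)
    (w : 'rV[R]_n) (ss : seq {set 'I_n}) : 'rV[R]_n :=
  \row_i let j := find (fun S : {set 'I_n} => i \in S) ss in
    (w 0 i)^-1 * hfun f w (prefix_union ss j) (nth set0 ss j).

(* Main.v *)
Require Import Defs.
From HB Require Import structures.
From mathcomp Require Import all_boot all_order all_algebra all_fingroup.
From mathcomp Require Import reals.
From mathcomp Require Import lra.

Set Implicit Arguments.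
Unset Strict Implicit.
Unset Printing Implicit Defensive.

Import Order.TTheory GRing.Theory Num.Theory.
Local Open Scope ring_scope.

(** Write v for the least ratio f(S) / w^-1(S), attained at Sstar; the proof
    bounds the value on both sides by v.

    Player 1 cannot secure more than v: if every w_j x_j is at least u on
    Sstar, then u w^-1(Sstar) <= x(Sstar) <= f(Sstar) ([secured_le_ratio]).
    The strategy y^Sstar turns this around for Player 2: against it the payoff
    of x is the weighted average x(Sstar) / w^-1(Sstar), at most v.

    Conversely, every decomposition secures v for Player 1. The ratios
    h_(S^j)(S_(j+1)) chosen along it are nondecreasing in j, since choosing
    S_(j+1) and S_(j+2) together was already possible at step j
    ([hfun_next_ge]); the first ratio being at least v, so are all of them
    ([hfun_ge]), and w_i x_i is one of these ratios for every i. The point x is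
    in the base polyhedron because, by minimality of each ratio, x never gains
    more on a part of a block than f does, and submodularity adds up such
    bounds over the blocks ([chain_sum_le], [xstrat_base]).

    The same lemma [chain_sum_le], applied to the chain of singletons added by
    a permutation, bounds the vertices of the base polyhedron
    ([vertex_sum_le]). Since Player 2's guarantee only ranges over vertices,
    one needs moreover that no point of the base polyhedron beats all of them
    against a given y: this is the optimality of the greedy algorithm, proved
    by sorting y and summing by parts ([greedy_vertex]). *)

(** * The weights of sets *)

Lemma winv_gt0 (R : realType) (n : nat) (w : 'rV[R]_n) (S : {set 'I_n}) :
  (forall i, 0 < w 0 i) -> S != set0 -> 0 < winv w S.
Proof.
move=> w_gt0 /set0Pn[i iS]; rewrite /winv (bigD1 i) //=.
by apply: ltr_wpDr; rewrite ?invr_gt0 ?sumr_ge0 // => j _; rewrite invr_ge0 ltW.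
Qed.

Lemma sum_setU (V : nmodType) (I : finType) (F : I -> V) (A B : {set I}) :
  B \subset ~: A ->
  \sum_(i in A :|: B) F i = \sum_(i in A) F i + \sum_(i in B) F i.
Proof.
move=> BA; rewrite (big_setID A) setUK setDUl setDv set0U /=.
by rewrite setDE (setIidPl BA).
Qed.

(** * Submodular bounds along a chain *)

(** Submodularity says that the increment of f produced by a fixed set D
    only grows when the set it is added to shrinks. Hence a bound by the
    increment over the whole of P k may be weakened to the increment over
    S :&: P k, and these telescope to f S. *)
Lemma chain_sum_le (R : realType) (n : nat) (f : {set 'I_n} -> R)
    (x : 'rV[R]_n) (P : nat -> {set 'I_n}) (m : nat) :
  submodular f -> f set0 = 0 -> P 0%N = set0 -> P m = [set: 'I_n] ->
  (forall k, (k < m)%N -> P k \subset P k.+1) ->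
  (forall k (S : {set 'I_n}), (k < m)%N -> S \subset P k.+1 :\: P k ->
     \sum_(i in S) x 0 i <= f (P k :|: S) - f (P k)) ->
  forall S : {set 'I_n}, \sum_(i in S) x 0 i <= f S.
Proof.
move=> submod f0 P0 Pm P_incr x_step S.
suff: forall k, (k <= m)%N ->
    \sum_(i in S :&: P k) x 0 i <= f (S :&: P k).
  by move=> /(_ m (leqnn m)); rewrite Pm setIT.
elim=> [_|k IHk km]; first by rewrite P0 setI0 big_set0 f0.
set D := S :&: (P k.+1 :\: P k).
have splitS : S :&: P k.+1 = (S :&: P k) :|: D.
  rewrite /D -setIUr; congr (_ :&: _).
  by rewrite -{1}(setID (P k.+1) (P k)) (setIidPr (P_incr k km)).
have D_new : D \subset ~: (S :&: P k).
  by apply/subsetP=> i; rewrite !inE negb_and => /and3P[_ -> _]; rewrite orbT.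
have unionD : (S :&: P k.+1) :|: P k = P k :|: D.
  by rewrite splitS setUC setUA (setUidPl (subsetIr _ _)).
have interD : (S :&: P k.+1) :&: P k = S :&: P k.
  by rewrite -setIA (setIidPr (P_incr k km)).
(* Adding D to S :&: P k increases f at least as much as adding it to P k. *)
have := submod (S :&: P k.+1) (P k); rewrite unionD interD.
have := x_step k D km (subsetIr _ _); have := IHk (ltnW km).
rewrite [in X in _ -> _ -> _ -> X <= _]splitS sum_setU //; lra.
Qed.

Definition perm_prefix (n : nat) (s : 'S_n) (k : nat) : {set 'I_n} :=
  s @: [set j : 'I_n | (j < k)%N].

Lemma perm_prefix0 (n : nat) (s : 'S_n) : perm_prefix s 0 = set0.
Proof. by apply/setP=> i; rewrite inE; apply/imsetP=> -[j]; rewrite inE. Qed.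

Lemma perm_prefix_full (n : nat) (s : 'S_n) : perm_prefix s n = [set: 'I_n].
Proof.
apply/setP=> i; rewrite inE; apply/imsetP.
by exists ((s^-1)%g i); rewrite ?inE ?permKV.
Qed.

Lemma perm_prefixS (n : nat) (s : 'S_n) (k : 'I_n) :
  perm_prefix s k.+1 = s k |: perm_prefix s k.
Proof.
rewrite /perm_prefix -imsetU1.
have -> // : [set j : 'I_n | (j < k.+1)%N] = k |: [set j : 'I_n | (j < k)%N].
by apply/setP=> j; rewrite !inE ltnS leq_eqVlt -val_eqE.
Qed.

Lemma perm_prefix_notin (n : nat) (s : 'S_n) (k : 'I_n) :
  s k \notin perm_prefix s k.
Proof. by rewrite mem_imset ?inE ?ltnn //; apply: perm_inj. Qed.

Lemma vertex_perm (R : realType) (n : nat) (f : {set 'I_n} -> R) (s : 'S_n)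
    (k : 'I_n) :
  vertex f s 0 (s k) = f (perm_prefix s k.+1) - f (perm_prefix s k).
Proof. by rewrite mxE permK. Qed.

(** Each step of the chain of prefixes adds one point, where the coordinate
    of the vertex is by definition the increment of f. *)
Lemma vertex_sum_le (R : realType) (n : nat) (f : {set 'I_n} -> R) (s : 'S_n) :
  submodular f -> f set0 = 0 ->
  forall S : {set 'I_n}, \sum_(i in S) vertex f s 0 i <= f S.
Proof.
move=> submod f0.
apply: (chain_sum_le submod f0 (perm_prefix0 s) (perm_prefix_full s)).
  by move=> k kn; rewrite (perm_prefixS s (Ordinal kn)) subsetUr.
move=> k S kn; rewrite (perm_prefixS s (Ordinal kn)) setDUl setDv setU0 => SD.
have := subset_trans SD (subsetDl _ _).
rewrite subset1 => /orP[/eqP->|/eqP->].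
  by rewrite big_set1 vertex_perm perm_prefixS setUC.
by rewrite big_set0 setU0 subrr.
Qed.

(** * The greedy algorithm over the base polyhedron *)

(** Summation by parts writes the sum as D n * z n.-1 plus the terms
    D k * (z k.-1 - z k), all nonnegative as D n vanishes. *)
Lemma abel_sum_ge (R : realDomainType) (D z : nat -> R) (n : nat) :
  D 0%N = 0 -> (forall k, (k <= n)%N -> 0 <= D k) -> D n = 0 ->
  (forall k, (k.+1 < n)%N -> z k.+1 <= z k) ->
  0 <= \sum_(0 <= k < n) (D k.+1 - D k) * z k.
Proof.
case: n => [|n] D0 D_ge0 Dn z_noninc; first by rewrite big_geq.
(* The left-hand side is the boundary term of the partial sum. *)
suff: forall k, (k <= n)%N ->
    D k.+1 * z k <= \sum_(0 <= j < k.+1) (D j.+1 - D j) * z j.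
  by move=> /(_ n (leqnn n)); rewrite Dn mul0r.
elim=> [_|k IHk kn]; first by rewrite big_nat1 D0 subr0.
rewrite big_nat_recr //= mulrBl.
have := IHk (ltnW kn).
have : D k.+1 * z k.+1 <= D k.+1 * z k.
  by rewrite ler_wpM2l ?z_noninc ?D_ge0 //= ltnW.
lra.
Qed.

Lemma perm_sorting (d : Order.disp_t) (T : orderType d) (n : nat)
    (z : 'I_n -> T) :
  exists s : 'S_n, forall i j : 'I_n, (i <= j)%N -> (z (s j) <= z (s i))%O.
Proof.
pose leT i j := (z j <= z i)%O.
have /tuple_permP[s sE] : perm_eq (sort leT (ord_tuple n)) (ord_tuple n).
  by rewrite perm_sort.
have leT_total : total leT by move=> i j; apply: le_total.
have leT_trans : transitive leT by move=> j i k ij jk; apply: le_trans jk ij.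
have leT_refl : reflexive leT by move=> i; apply: lexx.
exists s => i j ij.
have := sorted_leq_nth leT_trans leT_refl i (sort_sorted leT_total (ord_tuple n)).
rewrite sE => /(_ i j); rewrite !inE size_tuple => /(_ (ltn_ord _) (ltn_ord _) ij).
by rewrite -!tnth_nth !tnth_mktuple !tnth_ord_tuple.
Qed.

(** Edmonds' greedy algorithm: the vertex built in decreasing order of y
    maximizes the linear form y, because it fills every prefix of that order to
    its capacity f, while x leaves there a slack D >= 0 that is null on the
    full set. *)
Lemma greedy_vertex (R : realType) (n : nat) (f : {set 'I_n} -> R)
    (y : 'rV[R]_n) :
  f set0 = 0 ->
  exists s : 'S_n, forall x, base_polyhedron f x ->
    expected_payoff x y <= expected_payoff (vertex f s) y.
Proof.
move=> f0; have [s s_sorted] := perm_sorting (fun i => y 0 i).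
exists s => x [_ x_le x_tot].
pose D k := f (perm_prefix s k) - \sum_(i in perm_prefix s k) x 0 i.
pose z k := if insub k is Some i then y 0 (s i) else 0.
have zE (i : 'I_n) : z i = y 0 (s i) by rewrite /z valK.
rewrite -subr_ge0 /expected_payoff -sumrB (reindex_inj (@perm_inj _ s)) /=.
have -> : \sum_j (vertex f s 0 (s j) * y 0 (s j) - x 0 (s j) * y 0 (s j)) =
    \sum_(0 <= k < n) (D k.+1 - D k) * z k.
  rewrite big_mkord; apply: eq_bigr => j _; rewrite -mulrBl zE; congr (_ * _).
  rewrite vertex_perm /D perm_prefixS big_setU1 ?perm_prefix_notin //=; lra.
apply: abel_sum_ge => [|k _||k kn].
- by rewrite /D perm_prefix0 f0 big_set0 subrr.
- by rewrite subr_ge0.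
- by rewrite /D perm_prefix_full x_tot subrr.
by rewrite -[k.+1]/(val (Ordinal kn)) -[k]/(val (Ordinal (ltnW kn))) !zE s_sorted.
Qed.

(** * Decompositions and their strategies *)

(** The choices made by a possibly unfinished decomposition, so that
    decompositions can be built one block at a time. *)
Definition greedy_steps (R : realType) (n : nat) (f : {set 'I_n} -> R)
    (w : 'rV[R]_n) (ss : seq {set 'I_n}) : Prop :=
  forall j, (j < size ss)%N ->
    let T := prefix_union ss j in
    let S := nth set0 ss j in
    [/\ S != set0, S \subset ~: T
      & forall S' : {set 'I_n}, S' != set0 -> S' \subset ~: T ->
          hfun f w T S <= hfun f w T S'].

Lemma prefix_union0 (n : nat) (ss : seq {set 'I_n}) :
  prefix_union ss 0 = set0.
Proof. by rewrite /prefix_union take0 big_nil. Qed.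

Lemma prefix_unionS (n : nat) (ss : seq {set 'I_n}) (j : nat) :
  (j < size ss)%N ->
  prefix_union ss j.+1 = prefix_union ss j :|: nth set0 ss j.
Proof. by move=> jss; rewrite /prefix_union (take_nth set0) // big_rcons. Qed.

Lemma in_prefix_union (n : nat) (ss : seq {set 'I_n}) (j : nat) (i : 'I_n) :
  (i \in prefix_union ss j) = has (fun S : {set 'I_n} => i \in S) (take j ss).
Proof.
rewrite /prefix_union; elim: (take j ss) => [|S r IHr].
  by rewrite big_nil inE.
by rewrite big_cons inE IHr.
Qed.

(** Each block strictly shrinks the finite complement of the prefix union,
    so adding minimizing blocks ends up exhausting the ground set. *)
Lemma fw_decomposition_exists (R : realType) (n : nat) (f : {set 'I_n} -> R)
    (w : 'rV[R]_n) : exists ss, fw_decomposition f w ss.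
Proof.
suff extend k (ss : seq {set 'I_n}) : greedy_steps f w ss ->
    (#|~: prefix_union ss (size ss)| <= k)%N -> exists ss', fw_decomposition f w ss'.
  by apply: (extend _ [::] _ (leqnn _)).
elim: k ss => [|k IHk] ss ss_greedy; set T := prefix_union ss _ => cardT.
  exists ss; split => //; rewrite -/T -[T]setCK -setC0; congr (~: _).
  by apply/eqP; rewrite -cards_eq0 -leqn0.
have [TV|TV] := eqVneq (~: T) set0.
  by exists ss; split => //; rewrite -/T -[T]setCK TV setC0.
pose admissible (S : {set 'I_n}) := (S != set0) && (S \subset ~: T).
have admissibleT : admissible (~: T) by rewrite /admissible TV /=.
have [S /andP[S0 ST] S_min] := arg_minP (hfun f w T) admissibleT.
have prefix_rcons j : (j <= size ss)%N ->
    prefix_union (rcons ss S) j = prefix_union ss j.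
  by move=> jss; rewrite /prefix_union -cats1 takel_cat.
apply: (IHk (rcons ss S)).
  move=> j; rewrite size_rcons ltnS => jss; rewrite prefix_rcons // nth_rcons.
  move: jss; rewrite leq_eqVlt => /orP[/eqP->|jss]; last first.
    by rewrite jss; apply: ss_greedy.
  rewrite ltnn eqxx; split=> // S' S'0 S'T.
  by apply: S_min; rewrite /admissible S'0.
rewrite size_rcons prefix_unionS ?size_rcons // prefix_rcons // -/T.
rewrite nth_rcons ltnn eqxx -ltnS; apply: leq_trans cardT.
apply: proper_card; rewrite setCU; apply/properP; split; first exact: subsetIl.
have [i iS] := set0Pn _ S0; exists i; first exact: (subsetP ST).
by rewrite !inE iS andbF.
Qed.

(** The blocks being disjoint, the search for i in [xstrat] stops at the
    block that contains i and not before. *)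
Lemma xstrat_step (R : realType) (n : nat) (f : {set 'I_n} -> R)
    (w : 'rV[R]_n) (ss : seq {set 'I_n}) (j : nat) (i : 'I_n) :
  (j < size ss)%N -> nth set0 ss j \subset ~: prefix_union ss j ->
  i \in nth set0 ss j ->
  xstrat f w ss 0 i =
    (w 0 i)^-1 * hfun f w (prefix_union ss j) (nth set0 ss j).
Proof.
move=> jss disj iS; rewrite mxE.
suff -> : find (fun S : {set 'I_n} => i \in S) ss = j by [].
have := subsetP disj i iS; rewrite inE in_prefix_union => /negPf i_before.
rewrite -{1}(cat_take_drop j ss) find_cat i_before (drop_nth set0) //= iS addn0.
by rewrite size_takel // ltnW.
Qed.

(** The ratio of S1 :|: S2 over T is the mediant of the ratio of S1 over T
    and of that of S2 over T :|: S1; if it is at least the former, so is the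
    latter. *)
Lemma hfun_next_ge (R : realType) (n : nat) (f : {set 'I_n} -> R)
    (w : 'rV[R]_n) (T S1 S2 : {set 'I_n}) :
  (forall i, 0 < w 0 i) -> S1 != set0 -> S2 != set0 ->
  S2 \subset ~: S1 ->
  hfun f w T S1 <= hfun f w T (S1 :|: S2) ->
  hfun f w T S1 <= hfun f w (T :|: S1) S2.
Proof.
move=> w_gt0 S1_neq0 S2_neq0 disj.
have w1 := winv_gt0 w_gt0 S1_neq0; have w2 := winv_gt0 w_gt0 S2_neq0.
have : hfun f w T S1 * winv w S1 = f (T :|: S1) - f T by rewrite divfK ?gt_eqF.
set h1 := hfun f w T S1; rewrite /hfun setUA /winv sum_setU // -!/(winv _ _).
rewrite !ler_pdivlMr ?addr_gt0 // mulrDr.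
lra.
Qed.

Lemma hfun_ge (R : realType) (n : nat) (f : {set 'I_n} -> R)
    (w : 'rV[R]_n) (v : R) (ss : seq {set 'I_n}) :
  (forall i, 0 < w 0 i) -> greedy_steps f w ss ->
  (forall S, S != set0 -> v <= hfun f w set0 S) ->
  forall j, (j < size ss)%N ->
    v <= hfun f w (prefix_union ss j) (nth set0 ss j).
Proof.
move=> w_gt0 steps v_le; elim=> [|j IHj] jss.
  by rewrite prefix_union0; apply: v_le; case: (steps 0%N jss).
have [S1_neq0 S1T S1_min] := steps j (ltnW jss).
have [S2_neq0 S2T _] := steps _ jss.
apply: (le_trans (IHj (ltnW jss))).
move: S2T; rewrite prefix_unionS 1?ltnW // setCU subsetI => /andP[S2T S2S1].
apply: hfun_next_ge => //; apply: S1_min.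
  by apply: contraNneq S1_neq0 => /eqP; rewrite setU_eq0 => /andP[].
by rewrite subUset S1T.
Qed.

Lemma in_some_step (n : nat) (ss : seq {set 'I_n}) (i : 'I_n) :
  prefix_union ss (size ss) = [set: 'I_n] ->
  exists2 j, (j < size ss)%N & i \in nth set0 ss j.
Proof.
move=> full; have : i \in prefix_union ss (size ss) by rewrite full inE.
by rewrite in_prefix_union take_size => /(has_nthP set0).
Qed.

(** On a part S of a block, x(S) is the ratio of the block times w^-1(S),
    hence at most the increment of f by S because the ratio is minimal; on the
    whole block the two agree, which telescopes to x(V) = f(V).
    Monotonicity of f makes the ratios, hence x, nonnegative. *)
Lemma xstrat_base (R : realType) (n : nat) (f : {set 'I_n} -> R)
    (w : 'rV[R]_n) (ss : seq {set 'I_n}) :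
  nondecreasing_setfun f -> submodular f -> f set0 = 0 ->
  (forall i, 0 < w 0 i) -> fw_decomposition f w ss ->
  base_polyhedron f (xstrat f w ss).
Proof.
move=> f_mono submod f0 w_gt0 [steps full]; set x := xstrat f w ss.
have x_sum j (S : {set 'I_n}) : (j < size ss)%N -> S \subset nth set0 ss j ->
    \sum_(i in S) x 0 i =
      hfun f w (prefix_union ss j) (nth set0 ss j) * winv w S.
  move=> jss SS; have [_ disj _] := steps j jss.
  rewrite mulr_sumr; apply: eq_bigr => i iS.
  by rewrite mulrC; apply: xstrat_step => //; apply: (subsetP SS).
split.
- move=> i; have [j jss iS] := in_some_step i full.
  have [S_neq0 disj _] := steps j jss.
  rewrite /x (xstrat_step _ _ jss) // mulr_ge0 ?invr_ge0 ?(ltW (w_gt0 i)) //.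
  rewrite divr_ge0 ?(ltW (winv_gt0 w_gt0 S_neq0)) // subr_ge0.
  by apply: f_mono; apply: subsetUl.
- apply: (@chain_sum_le R n f x (prefix_union ss) (size ss)) => //.
  + exact: prefix_union0.
  + by move=> k kss; rewrite prefix_unionS // subsetUl.
  move=> k S kss; rewrite prefix_unionS //.
  rewrite setDUl setDv set0U => SD.
  have SS := subset_trans SD (subsetDl _ _).
  have [S_neq0 disj S_min] := steps k kss.
  rewrite (x_sum k) //; have [->|S0] := eqVneq S set0.
    by rewrite /winv big_set0 mulr0 setU0 subrr.
  rewrite -ler_pdivlMr ?(winv_gt0 w_gt0) //; apply: S_min => //.
  exact: subset_trans SS disj.
suff x_prefix k : (k <= size ss)%N ->
    \sum_(i in prefix_union ss k) x 0 i = f (prefix_union ss k).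
  by rewrite -full x_prefix.
elim: k => [_|k IHk kss]; first by rewrite prefix_union0 big_set0 f0.
have [S_neq0 disj _] := steps k kss.
rewrite prefix_unionS // sum_setU // (IHk (ltnW kss)) (x_sum k) //.
by rewrite divfK ?gt_eqF ?(winv_gt0 w_gt0) // addrC subrK.
Qed.

(** * Payoffs and the value of the game *)

Lemma expected_payoff_simplex (R : realType) (n : nat) (w x : 'rV[R]_n)
    (theta : 'I_n -> R) :
  expected_payoff x (\sum_j (theta j * w 0 j) *: delta_mx 0 j) =
    \sum_j theta j * (w 0 j * x 0 j).
Proof.
apply: eq_bigr => i _; rewrite summxE (bigD1 i) //= big1 => [|j ji].
  by rewrite !mxE !eqxx /= mulr1 addr0 mulrC mulrA.
by rewrite !mxE eq_sym (negPf ji) andbF mulr0.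
Qed.

Lemma expected_payoff_ystrat (R : realType) (n : nat) (w x : 'rV[R]_n)
    (S : {set 'I_n}) :
  expected_payoff x (ystrat w S) = (\sum_(i in S) x 0 i) / winv w S.
Proof.
rewrite mulr_suml big_mkcond; apply: eq_bigr => i _.
rewrite /ystrat mxE summxE; case: ifP => iS.
  rewrite (bigD1 i) //= big1 => [|j /andP[_ ji]].
    by rewrite mxE !eqxx addr0 mulr1.
  by rewrite mxE eq_sym (negPf ji) andbF.
rewrite big1 ?mulr0 // => j jS; rewrite mxE eqxx /=.
by case: eqP => // ij; rewrite ij jS in iS.
Qed.

Lemma ystrat_simplex (R : realType) (n : nat) (w : 'rV[R]_n)
    (S : {set 'I_n}) :
  (forall i, 0 < w 0 i) -> S != set0 -> simplexC w (ystrat w S).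
Proof.
move=> w_gt0 S_neq0; have wS := winv_gt0 w_gt0 S_neq0.
exists (fun j => if j \in S then (w 0 j)^-1 / winv w S else 0); split.
- by move=> j; case: ifP => // _; rewrite divr_ge0 ?invr_ge0 ?(ltW wS) ?(ltW (w_gt0 j)).
- by rewrite -big_mkcond /= -mulr_suml divff ?gt_eqF.
rewrite /ystrat scaler_sumr big_mkcond; apply: eq_bigr => j _.
case: ifP => _; last by rewrite mul0r scale0r.
by rewrite mulrAC mulVf ?gt_eqF // mul1r.
Qed.

(** Against a mixture with probabilities theta, the payoff is the average
    of the w_j x_j. *)
Lemma payoff_simplex_ge (R : realType) (n : nat) (w x y : 'rV[R]_n) (v : R) :
  (forall j, v <= w 0 j * x 0 j) -> simplexC w y -> v <= expected_payoff x y.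
Proof.
move=> x_ge [theta [theta_ge0 theta1 ->]]; rewrite expected_payoff_simplex.
rewrite -[v]mul1r -theta1 mulr_suml.
by apply: ler_sum => j _; rewrite ler_wpM2l.
Qed.

(** Weak duality on the single constraint x(S) <= f(S). *)
Lemma secured_le_ratio (R : realType) (n : nat) (f : {set 'I_n} -> R)
    (w x : 'rV[R]_n) (S : {set 'I_n}) (u : R) :
  (forall i, 0 < w 0 i) -> S != set0 -> base_polyhedron f x ->
  (forall j, j \in S -> u <= w 0 j * x 0 j) -> u <= f S / winv w S.
Proof.
move=> w_gt0 S_neq0 [_ x_le _] u_le.
rewrite ler_pdivlMr ?winv_gt0 //; apply: le_trans (x_le S).
rewrite mulr_sumr; apply: ler_sum => j jS.
by rewrite ler_pdivrMr // mulrC u_le.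
Qed.

Theorem theorem4 (R : realType) (n : nat) (n_ge1 : (1 <= n)%N)
    (f : {set 'I_n} -> R)
    (f_ge0 : forall S : {set 'I_n}, 0 <= f S)
    (f_nondecreasing : nondecreasing_setfun f)
    (f_submodular : submodular f)
    (f_set0 : f set0 = 0)
    (w : 'rV[R]_n) (w_gt0 : forall i : 'I_n, 0 < w 0 i)
    (Sstar : {set 'I_n}) (Sstar_neq0 : Sstar != set0)
    (Sstar_min : forall S : {set 'I_n}, S != set0 ->
       f Sstar / winv w Sstar <= f S / winv w S) :
  [/\ game_value f w (f Sstar / winv w Sstar),
      optimal2 f w (ystrat w Sstar)
    & forall ss : seq {set 'I_n}, fw_decomposition f w ss ->
        optimal1 f w (xstrat f w ss)].
Proof.
set v := f Sstar / winv w Sstar.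
have wS := winv_gt0 w_gt0 Sstar_neq0.
have yC := ystrat_simplex w_gt0 Sstar_neq0.
have x_secures ss : fw_decomposition f w ss ->
    forall j, v <= w 0 j * xstrat f w ss 0 j.
  move=> [steps full] i; have [j jss iS] := in_some_step i full.
  have [_ disj _] := steps j jss.
  rewrite (xstrat_step _ _ jss) // mulVKf ?gt_eqF //.
  apply: (hfun_ge w_gt0 steps) => // S S_neq0.
  by rewrite /hfun set0U f_set0 subr0 Sstar_min.
have x_guarantee ss : fw_decomposition f w ss -> guarantee1 w (xstrat f w ss) v.
  move=> ss_fw; split; last by move=> u [j ->]; apply: x_secures.
  (* The bound v is tight somewhere on Sstar: the least w_j x_j over Sstar is
     itself secured on Sstar, hence at most v. *)
  have [i iS] := set0Pn _ Sstar_neq0.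
  have [j jS j_min] := arg_minP (fun j => w 0 j * xstrat f w ss 0 j) iS.
  exists j; apply: le_anti; rewrite x_secures //=.
  by apply: (secured_le_ratio w_gt0 Sstar_neq0 (xstrat_base _ _ _ _ ss_fw)).
have [ss0 ss0_fw] := fw_decomposition_exists f w.
pose x0 := xstrat f w ss0.
have x0_base : base_polyhedron f x0 by apply: xstrat_base.
have x0_ge y : simplexC w y -> v <= expected_payoff x0 y.
  by apply: payoff_simplex_ge; apply: x_secures.
have y_le (x : 'rV[R]_n) : (forall S : {set 'I_n}, \sum_(i in S) x 0 i <= f S) ->
    expected_payoff x (ystrat w Sstar) <= v.
  by move=> x_le; rewrite expected_payoff_ystrat ler_pM2r ?invr_gt0.
(* x0 is a best reply to y^Sstar, which makes v an attained maximum and not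
   just an upper bound, over the polyhedron as well as over the vertices. *)
have x0y : v = expected_payoff x0 (ystrat w Sstar).
  by apply: le_anti; rewrite x0_ge //= y_le //; case: x0_base.
have value : game_value f w v.
  split; split.
  - by exists x0 => //; apply: x_guarantee.
  - move=> u [x x_base [_ u_le]].
    by apply: (secured_le_ratio w_gt0 Sstar_neq0 x_base) => j _; apply: u_le; exists j.
  - exists (ystrat w Sstar) => //.
    have [s s_max] := greedy_vertex (ystrat w Sstar) f_set0.
    have vertex_le s' : expected_payoff (vertex f s') (ystrat w Sstar) <= v.
      by apply: y_le; apply: vertex_sum_le.
    split; last by move=> _ [s' ->].
    by exists s; apply: le_anti; rewrite vertex_le {1}x0y s_max.
  move=> u [y y_C [_ u_ge]]; have [s s_max] := greedy_vertex y f_set0.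
  apply: (le_trans (x0_ge y y_C)); apply: (le_trans (s_max _ x0_base)).
  by apply: u_ge; exists s.
split=> // [|ss ss_fw].
  split=> //; exists v => //; split; first by exists x0.
  by move=> _ [x [_ x_le _] ->]; apply: y_le.
by split; [apply: xstrat_base|exists v => //; apply: x_guarantee].
Qed.
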